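(* Let $X$ be a non-empty Polish space without isolated points, let $f\colon X\to\mathbb{R}$, and let $\Sigma:=\mathrm{G_{Res}}$. Then the game $G_1(\Sigma,f)$ is determined, and - if $f$ is Baire measurable, then Player II has a winning strategy in the game $G_1(\Sigma,f)$; - if $f$ is not Baire measurable, then Player I has a winning strategy in the game $G_1(\Sigma,f)$.
   Context: $\mathrm{G_{Res}}$ is the family of all $G_\delta$ sets $G\subseteq X$ for which there is a non-empty open set $U\subseteq X$ such that $G$ is residual in $U$ (i.e. $G\subseteq U$ and $U\setminus G$ is meager). A function $f\colon X\to\mathbb{R}$ is Baire measurable if it is measurable with respect to the $\sigma$-algebra of sets with the Baire property. The game $G_1(\Sigma,f)$, for a non-empty family $\Sigma$ of non-empty subsets of $X$ and $f\colon X\to\mathbb{R}$: Player I plays $P\in\Sigma$, Player II plays $P_0$; then at the $n$th step ($n\ge1$) Player I plays a point $x_n$ and Player II plays a set $P_n$. The rules are: $P_n\in\Sigma$ and $P_n\subseteq P$ for all $n\ge0$ (the $P_n$ need not be decreasing), and $x_{n+1}\in P_n$ for all $n\ge 0$. Player II wins if $\langle x_n\rangle$ converges in $X$ and $\lim_{n}f(x_n)=f(\lim_{n}x_n)$; otherwise Player I wins. The game is determined if one of the players has a winning strategy. *)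

(* Defs.v *)
From HB Require Import structures.
From mathcomp Require Import all_boot all_order all_algebra.
From mathcomp Require Import all_classical all_reals all_analysis.
From mathcomp Require Import borel_hierarchy.

Set Implicit Arguments.
Unset Strict Implicit.
Unset Printing Implicit Defensive.

Import Order.TTheory GRing.Theory Num.Theory.
Import numFieldNormedType.Exports.

Local Open Scope classical_set_scope.
Local Open Scope ring_scope.

Definition complete_metric (R : realType) (M : metricType R) : Prop :=
  forall u : nat -> M, cauchy (u @ \oo) -> exists l : M, u @ \oo --> l.

Definition homeomorphism (X Y : topologicalType) (h : X -> Y) : Prop :=
  exists k : Y -> X, [/\ cancel h k, cancel k h, continuous h & continuous k].

Definition completely_metrizable (R : realType) (X : topologicalType) : Prop :=
  exists (M : metricType R) (h : X -> M), complete_metric M /\ homeomorphism h.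

Definition separable (X : topologicalType) : Prop :=
  exists2 D : set X, countable D & dense D.

Definition polish (R : realType) (X : topologicalType) : Prop :=
  separable X /\ completely_metrizable R X.

Section category.
Context {X : topologicalType}.
Implicit Types A G U : set X.

Definition nowhere_dense A : Prop := interior (closure A) = set0.

Definition meager A : Prop :=
  exists2 F : nat -> set X,
    (forall n, nowhere_dense (F n)) & A = \bigcup_n F n.

Definition baire_property A : Prop :=
  exists2 U, open U & meager (A `+` U).

(* Measurability of f from the sigma-algebra of sets with the Baire property
   to the Borel sets of R. *)
Definition baire_measurable (R : realType) (f : X -> R) : Prop :=
  forall B : set R, measurable B -> baire_property (f @^-1` B).

Definition residual_in G U : Prop := G `<=` U /\ meager (U `\` G).

Definition G_Res : set (set X) :=
  [set G | Gdelta G /\ exists U, [/\ open U, U !=set0 & residual_in G U]].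

End category.

(* A run of G_1(Sigma, f) is encoded by Player I's opening set P, Player II's
   sets Q and Player I's points x, where Q n is P_n and x n is x_{n+1}: the
   moves are made in the order P, Q 0, x 0, Q 1, x 1, and so on.  The first
   player to break a rule loses. *)
Section game.
Context {X : topologicalType} {R : realType}.
Context (Sigma : set (set X)) (f : X -> R).

Definition legal_set (P Q : set X) : Prop := Sigma Q /\ Q `<=` P.

Definition II_wins_run (x : nat -> X) : Prop :=
  exists l : X, x @ \oo --> l /\ f (x n) @[n --> \oo] --> f l.

(* A strategy of Player I consists of an opening set and of a map sending the
   list of sets played so far by Player II to the next point. *)
Definition I_strategy := (set X * (seq (set X) -> X))%type.

Definition I_point (s : I_strategy) (Q : nat -> set X) (n : nat) : X :=
  s.2 (mkseq Q n.+1).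

Definition I_winning (s : I_strategy) : Prop :=
  Sigma s.1 /\
  forall Q : nat -> set X,
    (forall n, (forall k, (k <= n)%N -> legal_set s.1 (Q k)) ->
       Q n (I_point s Q n)) /\
    ((forall n, legal_set s.1 (Q n)) -> ~ II_wins_run (I_point s Q)).

(* A strategy of Player II maps the opening set and the list of points played
   so far by Player I to the next set. *)
Definition II_strategy := set X -> seq X -> set X.

Definition II_set (t : II_strategy) (P : set X) (x : nat -> X) (n : nat) :
    set X :=
  t P (mkseq x n).

Definition II_winning (t : II_strategy) : Prop :=
  forall (P : set X) (x : nat -> X), Sigma P ->
    (forall n, (forall k, (k < n)%N -> II_set t P x k (x k)) ->
       legal_set P (II_set t P x n)) /\
    ((forall n, II_set t P x n (x n)) -> II_wins_run x).

Definition I_has_winning_strategy : Prop := exists s, I_winning s.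

Definition II_has_winning_strategy : Prop := exists t, II_winning t.

Definition determined : Prop :=
  I_has_winning_strategy \/ II_has_winning_strategy.

End game.

(* Main.v *)
Require Import Defs.
From mathcomp Require Import all_boot all_order all_algebra.
From mathcomp Require Import all_classical all_reals all_analysis.
From mathcomp Require Import measurable_realfun borel_hierarchy lra.
Import Order.TTheory GRing.Theory Num.Theory.
Import numFieldNormedType.Exports.
Local Open Scope classical_set_scope.

Set Implicit Arguments.
Unset Strict Implicit.
Unset Printing Implicit Defensive.

(** A Baire measurable function is exactly one that becomes continuous after the
removal of a meager set, and each half of the dichotomy yields a strategy that
is almost blind to the moves of the opponent.

If [f] is Baire measurable, then it is continuous on some residual G-delta set
[G] ([open_preimages_continuous_off_meager], [meager_Gdelta]). An opening set
[P] is residual in a non-empty open set, so by the Baire category theorem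
([complete_baire]) it contains a point [p] of [G]. Player II plays the traces of
[P `&` G] on balls around [p] with radii tending to 0: these are again in
[G_Res], and they force the points of Player I to converge to [p] within [G]
([II_wins_continuous]).

If [f] is not Baire measurable, then there are [a < b] and a non-empty open set
[U] such that both [f < a] and [f > b] are nonmeager in each non-empty open
subset of [U] ([not_baire_measurable_oscillation]). Player I opens with [U].
Each answer of Player II contains a residual part of some non-empty open subset
of [U], hence meets both [f < a] and [f > b]; alternating between them, Player I
makes the values of [f] diverge ([I_wins_oscillating]). *)

(** * Meager sets and the Baire property *)

Section meager_ideal.
Context {X : topologicalType}.
Implicit Types A B C U V : set X.

Lemma nowhere_dense_sub A B : A `<=` B -> nowhere_dense B -> nowhere_dense A.
Proof.
move=> AB B0; rewrite /nowhere_dense -subset0 -B0.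
exact/interiorS/closureS.
Qed.

(** Replacing the sequence and the equality of the definition by a countable
family and an inclusion makes stability under subsets and under countable
unions immediate. *)
Lemma meagerP A :
  meager A <-> exists S : set (set X),
    [/\ countable S, S `<=` nowhere_dense & A `<=` \bigcup_(N in S) N].
Proof.
split=> [[F ndF ->]|[S [cS ndS AS]]].
  exists (range F); split; first exact: card_image_le.
    by move=> _ [n _ <-].
  by move=> x [n _ Fx]; exists (F n) => //; exists n.
have [S0|[g]] := pfcard_geP cS.
  exists (fun=> set0).
    by move=> n; rewrite /nowhere_dense closure0 interior0.
  by apply/seteqP; split=> [x /AS|x [//]]; rewrite S0 => -[].
exists (fun n => g n `&` A).
  move=> n; apply: (@nowhere_dense_sub _ (g n)); first exact: subIsetl.
  exact/ndS/(@funS _ _ _ _ g).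
apply/seteqP; split=> [x Ax|x [n _ []//]].
have [N SN Nx] := AS x Ax.
have [n _ gn] := @surj _ _ _ _ g N SN.
by exists n => //; rewrite gn.
Qed.

Lemma meager_sub A B : A `<=` B -> meager B -> meager A.
Proof.
move=> AB /meagerP[S [cS ndS BS]]; apply/meagerP; exists S; split => //.
exact: subset_trans BS.
Qed.

Lemma nowhere_dense_meager A : nowhere_dense A -> meager A.
Proof.
move=> ndA; apply/meagerP; exists [set A]; split; first exact: countable1.
  by move=> _ ->.
by rewrite bigcup_set1.
Qed.

Lemma meager0 : meager (@set0 X).
Proof.
by apply: nowhere_dense_meager; rewrite /nowhere_dense closure0 interior0.
Qed.

Lemma meager_bigcup (I : Type) (D : set I) (F : I -> set X) : countable D ->
  (forall i, D i -> meager (F i)) -> meager (\bigcup_(i in D) F i).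
Proof.
move=> cD mF.
have /choice[S SP] : forall i, exists S : set (set X), D i ->
    [/\ countable S, S `<=` nowhere_dense & F i `<=` \bigcup_(N in S) N].
  move=> i; have [Di|nDi] := pselect (D i); last by exists set0.
  by have /meagerP[S ?] := mF i Di; exists S.
apply/meagerP; exists (\bigcup_(i in D) S i); split.
- by apply: bigcup_countable => // i /SP[].
- by move=> N [i /SP[_ + _]]; exact.
- move=> x [i Di Fx]; have [_ _ /(_ x Fx)[N SN Nx]] := SP i Di.
  by exists N => //; exists i.
Qed.

Lemma meagerU A B : meager A -> meager B -> meager (A `|` B).
Proof.
move=> mA mB; rewrite -bigcup2E; apply: meager_bigcup => // -[|[|n]] _ //=.
exact: meager0.
Qed.

(** An open set inside the closure of the frontier would lie in [A], hence in the
interior of [A], which the frontier avoids. *)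
Lemma nowhere_dense_closedD A : closed A -> nowhere_dense (A `\` A°).
Proof.
move=> cA; rewrite /nowhere_dense -subset0 => x.
have clA : closure (A `\` A°) `<=` A.
  by rewrite {3}((closure_id A).1 cA); apply: closureS; exact: subDsetl.
move=> ix; have := interior_subset ix => /(_ (closure (A `\` A°))°).
case; first exact: open_nbhs_nbhs (conj (open_interior _) ix).
by move=> y [[_ nAy]] /(interiorS clA).
Qed.

(** The closures of nowhere dense sets are still nowhere dense, so the set of
points outside all of them is residual; this turns residual sets into the
G-delta sets that the game allows. *)
Lemma meager_Gdelta A : meager A ->
  exists G, [/\ Gdelta G, G `<=` ~` A & meager (~` G)].
Proof.
move=> [F ndF ->]; exists (\bigcap_n ~` closure (F n)); split.
- exists (fun n => ~` closure (F n)) => // n.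
  exact/closed_openC/closed_closure.
- by rewrite setC_bigcup => x Gx n _ /subset_closure; exact: Gx.
- rewrite setC_bigcap; apply: meager_bigcup => // n _; rewrite setCK.
  apply: nowhere_dense_meager; rewrite /nowhere_dense.
  by rewrite -(closure_id _).1 ?ndF//; exact: closed_closure.
Qed.

Lemma baire_property_mod A B : meager (A `+` B) ->
  baire_property B -> baire_property A.
Proof.
move=> mAB [U oU mBU]; exists U => //.
apply: meager_sub (meagerU mAB mBU) => x /=.
by have [] := pselect (B x); tauto.
Qed.

Lemma closed_baire_property A : closed A -> baire_property A.
Proof.
move=> cA; exists A°; first exact: open_interior.
apply: meager_sub (nowhere_dense_meager (nowhere_dense_closedD cA)) => x.
by case=> -[] // /interior_subset.
Qed.

Lemma baire_propertyC A : baire_property A -> baire_property (~` A).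
Proof.
move=> [U oU mAU]; apply: (@baire_property_mod _ (~` U)).
  apply: meager_sub mAU => x /=.
  by have [] := pselect (U x); have [] := pselect (A x); tauto.
by apply: closed_baire_property; exact: open_closedC.
Qed.

Lemma baire_property_bigcup (I : Type) (D : set I) (F : I -> set X) :
  countable D -> (forall i, D i -> baire_property (F i)) ->
  baire_property (\bigcup_(i in D) F i).
Proof.
move=> cD bF.
have /choice[V VP] : forall i, exists V, D i -> open V /\ meager (F i `+` V).
  move=> i; have [Di|nDi] := pselect (D i); last by exists set0.
  by have [V ? ?] := bF i Di; exists V.
exists (\bigcup_(i in D) V i); first by apply: bigcup_open => i /VP[].
apply: (@meager_sub _ (\bigcup_(i in D) (F i `+` V i))).
  move=> x [[[i Di Fx] nV]|[[i Di Vx] nF]]; exists i => //.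
    by left; split => // Vx; apply: nV; exists i.
  by right; split => // Fx; apply: nF; exists i.
by apply: meager_bigcup => // i /VP[].
Qed.

End meager_ideal.

(** * Metrics compatible with a Polish topology *)

Section compatible_metric.
Local Open Scope ring_scope.
Context {R : realType} {X : topologicalType}.

(** The metric is a function and not a [metricType] structure, because [X] comes
with its own topology and need not carry a canonical metric. *)
Record compatible_metric (d : X -> X -> R) : Prop := CompatibleMetric {
  cm_refl : forall x, d x x = 0 ;
  cm_sym : forall x y, d x y = d y x ;
  cm_triangle : forall y x z, d x z <= d x y + d y z ;
  cm_nbhs : forall x A,
    nbhs x A <-> exists2 e, 0 < e & [set y | d x y < e] `<=` A
}.

(** The hypothesis compares the terms of a tail with its first term only; by the
triangle inequality it is the Cauchy condition up to a factor 2. *)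
Definition cauchy_complete (d : X -> X -> R) : Prop :=
  forall u : nat -> X,
    (forall e, 0 < e -> exists N, forall n, (N <= n)%N -> d (u N) (u n) < e) ->
    exists l : X, u @ \oo --> l.

(** The complete metric is pulled back along the homeomorphism, so that all later
arguments take place in [X] itself. *)
Lemma completely_metrizable_metric : completely_metrizable R X ->
  exists d, compatible_metric d /\ cauchy_complete d.
Proof.
move=> [M [h [cM [k [hK kK ch ck]]]]].
exists (fun x y => mdist (h x) (h y)); split; first split.
- by move=> x; rewrite mdistxx.
- by move=> x y; rewrite metric_sym.
- by move=> y x z; exact: metric_triangle.
- move=> x A; split=> [Ax|[e e0 xeA]].
    have /nbhs_ballP[e /= e0 heA] : nbhs (h x) (k @^-1` A).
      by apply: ck; rewrite hK.
    exists e => // y /= xy; rewrite -(hK y); apply: heA.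
    by rewrite ballEmdist.
  apply: (@filterS _ _ _ (h @^-1` ball (h x) e)).
    by move=> y; rewrite /= ballEmdist => /xeA.
  by apply: ch; exact: nbhsx_ballx.
- move=> u cu.
  have [l hul] : exists l : M, h \o u @ \oo --> l.
    apply: cM; apply: cauchy_exP => e /cu[N uN]; exists (h (u N)).
    by exists N => // n /= Nn; rewrite ballEmdist; exact: uN.
  exists (k l); rewrite (_ : u = k \o (h \o u)); last first.
    by apply/funext => n /=; rewrite hK.
  exact: continuous_cvg (ck l) hul.
Qed.

Context (d : X -> X -> R) (cd : compatible_metric d).

Lemma open_metric_ball x e : open [set y | d x y < e].
Proof.
rewrite openE => y /= xy; apply/(cm_nbhs cd).
exists (e - d x y); first by rewrite subr_gt0.
by move=> z /= yz; have := cm_triangle cd y x z; lra.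
Qed.

Lemma near_metric_ball x e : 0 < e -> nbhs x [set y | d x y < e].
Proof. by move=> e0; apply/(cm_nbhs cd); exists e. Qed.

(** The balls of radius [1 / (n + 1)] around the points of a countable dense set
form a countable basis. *)
Lemma separable_second_countable : separable X -> @second_countable X.
Proof.
move=> [D cD dD].
pose b (q : X * nat) := [set y | d q.1 y < q.2.+1%:R^-1].
exists (b @` (D `*` setT)).
  apply: sub_countable (card_image_le _ _) _.
  by apply: countableX => //; exact: countableP.
split; first by move=> _ [[x n] _ <-]; exact: open_metric_ball.
move=> x A /(cm_nbhs cd)[e e0 xeA].
have [n] : exists n, n.+1%:R^-1 < e / 2.
  have [//|n] := @ltr_add_invr R 0 (e / 2) _; first by rewrite divr_gt0.
  by rewrite add0r; exists n.
set r := n.+1%:R^-1 => re.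
have [||y [xy Dy]] := dD [set y | d x y < r].
- by exists x; rewrite /= (cm_refl cd) invr_gt0.
- exact: open_metric_ball.
exists (b (y, n)); first split.
- by exists (y, n).
- by rewrite /b /= (cm_sym cd).
- move=> z; rewrite /b /= -/r => yz; apply: xeA => /=.
  by move: xy => /= xy; have := cm_triangle cd y x z; lra.
Qed.

(** Baire category theorem. If [U] were the union of the nowhere dense sets
[F n], one could choose a sequence of balls, the first inside [U], such that the
ball of index [n + 1] avoids [F n] and lies in the preceding one, even with its
boundary, and such that the radii tend to 0. The limit of the centres lies in
all the balls, hence in [U] but in no [F n]. *)
Lemma complete_baire : cauchy_complete d ->
  forall U : set X, open U -> U !=set0 -> ~ meager U.
Proof.
move=> completed U oU [x0 Ux0] [F ndF UF].
have /(cm_nbhs cd)[r0 r00 xrU] : nbhs x0 U by exact: open_nbhs_nbhs.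
have /choice[f fP] : forall p : nat * (X * R), exists q : X * R, 0 < p.2.2 ->
    [/\ 0 < q.2, q.2 <= p.1.+1%:R^-1 & forall z, d q.1 z <= q.2 ->
        d p.2.1 z < p.2.2 /\ ~ F p.1 z].
  move=> [n [x r]] /=; have [r_gt0|] := ltP 0 r; last by exists (x, r).
  (* A nowhere dense set cannot have the whole ball in its closure. *)
  have [y xy nFy] : exists2 y, d x y < r & ~ closure (F n) y.
    apply: contrapT => /forall2NP xF.
    suff : (closure (F n))° x by rewrite ndF.
    apply/(cm_nbhs cd); exists r => // y /= xy.
    by have [//|/contrapT] := xF y.
  have /(cm_nbhs cd)[e e0 yeF] :
      nbhs y ([set y | d x y < r] `&` ~` closure (F n)).
    apply: open_nbhs_nbhs; split => //.
    apply: openI; first exact: open_metric_ball.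
    exact/closed_openC/closed_closure.
  exists (y, Num.min (e / 2) n.+1%:R^-1) => _ /=; split.
  - by rewrite lt_min divr_gt0//= invr_gt0.
  - by rewrite ge_min lexx orbT.
  - move=> z; rewrite le_min => /andP[yz _].
    have [] := yeF z; first by rewrite /=; lra.
    by move=> ? nFz; split => // /subset_closure.
pose s := fix s n := if n is m.+1 then f (m, s m) else (x0, r0).
have s_gt0 n : 0 < (s n).2 by elim: n => //= n /(fP (n, s n))[].
have s_step n z : d (s n.+1).1 z <= (s n.+1).2 ->
    d (s n).1 z < (s n).2 /\ ~ F n z.
  by have [_ _] := fP (n, s n) (s_gt0 n); exact.
have s_small n : (s n.+1).2 <= n.+1%:R^-1.
  by have [] := fP (n, s n) (s_gt0 n).
have s_nested m z : d (s m).1 z < (s m).2 -> forall n, (n <= m)%N ->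
    d (s n).1 z < (s n).2.
  elim: m => [|m IH] smz n; first by rewrite leqn0 => /eqP ->.
  rewrite leq_eqVlt => /predU1P[-> //|nm]; apply: IH => //.
  by have [] := s_step m z (ltW smz).
have s_in n m : (n <= m)%N -> d (s n).1 (s m).1 < (s n).2.
  by apply: s_nested; rewrite (cm_refl cd).
have [l sl] : exists l : X, (fun n => (s n).1) @ \oo --> l.
  apply: completed => e e0.
  have [//|n] := @ltr_add_invr R 0 e _; rewrite add0r => ne.
  exists n.+1 => m nm; apply: (lt_le_trans (s_in _ _ nm)).
  exact: le_trans (s_small n) (ltW ne).
have s_lim n : d (s n).1 l <= (s n).2.
  apply/ler_addgt0Pl => e e0.
  have [N _ Nl] := sl _ (near_metric_ball l e0).
  have /= lm := Nl (maxn N n) (leq_maxl _ _).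
  have nm := s_in n (maxn N n) (leq_maxr _ _).
  have := cm_triangle cd (s (maxn N n)).1 (s n).1 l.
  by rewrite (cm_sym cd l) in lm; lra.
have : U l by apply: xrU; have [] := s_step 0%N l (s_lim 1%N).
by rewrite UF => -[n _]; have [] := s_step n l (s_lim n.+1).
Qed.

End compatible_metric.

Lemma realType_second_countable (R : realType) : @second_countable R.
Proof.
have absR : compatible_metric (fun x y : R => `|x - y|%R).
  split.
  - by move=> x; rewrite subrr normr0.
  - by move=> x y; rewrite distrC.
  - by move=> y x z; exact: ler_distD.
  - move=> x A; split=> [/nbhs_ballP[e]|[e ? ?]]; first by exists e.
    by apply/nbhs_ballP; exists e.
apply: (separable_second_countable absR).
exists (range ratr); last exact: dense_rat.
exact: sub_countable (card_image_le _ _) (countableP _).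
Qed.

(** * Functions that are not Baire measurable *)

Section nonmeager_locus.
Context {X : topologicalType}.
Implicit Types A U V : set X.

(** This is the closed set on which [A] is of the second category at each point;
in a second countable space its complement is the largest open set in which [A]
is meager. *)
Definition nonmeager_locus A : set X :=
  [set x | forall V, nbhs x V -> ~ meager (A `&` V)].

Lemma closed_nonmeager_locus A : closed (nonmeager_locus A).
Proof.
move=> x clx V /nbhs_interior/clx[y [yA yV]].
exact: yA.
Qed.

(** Banach's category theorem in the second countable case: the part of [A]
outside the locus is covered by the countably many basic open sets in which [A]
is meager. *)
Lemma meagerD_nonmeager_locus A : @second_countable X ->
  meager (A `\` nonmeager_locus A).
Proof.
move=> [B cB [oB basisB]].
apply: (@meager_sub _ _
    (\bigcup_(V in [set V | B V /\ meager (A `&` V)]) (A `&` V))).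
  move=> x [Ax /existsNP[W /not_implyP[xW /contrapT mAW]]].
  have [V [BV Vx] VW] := basisB x W xW.
  exists V => //; split => //; apply: meager_sub mAW.
  exact: setIS.
apply: meager_bigcup => [|V [_ //]].
by apply: sub_countable cB; apply: subset_card_le => V [].
Qed.

End nonmeager_locus.

Section oscillation.
Local Open Scope ring_scope.
Context {R : realType} {X : topologicalType} (f : X -> R).

(** Sets with the Baire property form a sigma-algebra, and the rays generate the
Borel sets. *)
Lemma baire_measurable_rays :
  (forall c, baire_property [set x | f x < c]) -> baire_measurable f.
Proof.
move=> bf.
suff : measurable `<=` [set B : set R | baire_property (f @^-1` B)] by [].
rewrite [measurable]RGenInftyO.measurableE; apply: smallest_sub => /=.
  split.
  - by rewrite /= preimage_set0; apply: closed_baire_property; exact: closed0.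
  - by move=> A bA; rewrite /= setTD preimage_setC; exact: baire_propertyC.
  - move=> A bA; rewrite /= preimage_bigcup.
    by apply: baire_property_bigcup => [|n _]; [exact: countableP|exact: bA].
move=> _ [c ->] /=; rewrite (_ : _ @^-1` _ = [set x | f x < c])//.
Qed.

(** A function that is not Baire measurable oscillates, in the sense of category,
between two fixed values everywhere in some open set. Otherwise the loci of
[f < a] and [f > b] have a nowhere dense intersection for all [a < b], and
[f < c] agrees up to a meager set with the union, over the rational [q < c], of
the loci of [f < q]. One inclusion holds because a set is contained in its locus
up to a meager set. For the other, let [m] be the midpoint of [q] and [c]: the
part of the locus of [f < q] where [f >= c] is a part of [f > m], so up to a
meager set it lies in the intersection of the loci of [f < q] and [f > m]. A
union of closed sets has the Baire property. *)
Lemma not_baire_measurable_oscillation : @second_countable X ->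
  ~ baire_measurable f ->
  exists a b (U : set X), [/\ a < b, open U, U !=set0,
    U `<=` nonmeager_locus [set x | f x < a] &
    U `<=` nonmeager_locus [set x | f x > b]].
Proof.
move=> scX; apply: contra_notP => noosc; apply: baire_measurable_rays => c.
pose lo a := [set x | f x < a]; pose hi b := [set x | f x > b].
have nd a b : a < b ->
    nowhere_dense (nonmeager_locus (lo a) `&` nonmeager_locus (hi b)).
  move=> ab; apply/eqP/negPn/negP => /set0P ne; apply: noosc.
  exists a, b, (nonmeager_locus (lo a) `&` nonmeager_locus (hi b))°.
  move: ne; rewrite -(closure_id _).1; last first.
    by apply: closedI; exact: closed_nonmeager_locus.
  move=> ne; split => //; first exact: open_interior.
  - by move=> x /interior_subset[].
  - by move=> x /interior_subset[].
pose Q := [set q : rat | ratr q < c].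
have cQ : countable Q by exact: countableP.
pose mid q := (ratr q + c) / 2.
apply: (@baire_property_mod _ _
    (\bigcup_(q in Q) nonmeager_locus (lo (ratr q)))).
  apply: (@meager_sub _ _
    (\bigcup_(q in Q) (lo (ratr q) `\` nonmeager_locus (lo (ratr q))) `|`
     \bigcup_(q in Q) ((hi (mid q) `\` nonmeager_locus (hi (mid q))) `|`
        (nonmeager_locus (lo (ratr q)) `&` nonmeager_locus (hi (mid q)))))).
    move=> x [[/= xc nL]|[[q qc Lx] /= /negP xc]].
      have /rat_in_itvoo[q] := xc; rewrite in_itv/= => /andP[xq qc].
      by left; exists q => //; split => // Lx; apply: nL; exists q.
    right; exists q => //; move: qc; rewrite /Q /= => qc.
    have [Hx|nHx] := pselect (nonmeager_locus (hi (mid q)) x); first by right.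
    by left; split => //; rewrite /hi /mid /=; move: xc; rewrite -leNgt; lra.
  apply: meagerU; apply: meager_bigcup => // q qc.
    exact: meagerD_nonmeager_locus.
  apply: meagerU; first exact: meagerD_nonmeager_locus.
  apply/nowhere_dense_meager/nd; move: qc; rewrite /Q /mid /=; lra.
apply: baire_property_bigcup => // q _.
exact/closed_baire_property/closed_nonmeager_locus.
Qed.

End oscillation.

(** * Continuity off a meager set *)

(** For each basic open [V] of the target, the preimage of [V] agrees with an
open set [W V] up to a meager set. Off the union of these countably many meager
sets, preimages of basic open sets are relatively open. *)
Lemma open_preimages_continuous_off_meager (X Y : topologicalType)
    (f : X -> Y) :
  @second_countable Y ->
  (forall V, open V -> baire_property (f @^-1` V)) ->
  exists2 N, meager N & {within ~` N, continuous f}.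
Proof.
move=> [B cB [oB basisB]] bf.
have /choice[W WP] : forall V, exists W : set X, B V ->
    open W /\ meager (f @^-1` V `+` W).
  move=> V; have [/oB oV|nBV] := pselect (B V); last by exists set0.
  by have [W ? ?] := bf V oV; exists W.
exists (\bigcup_(V in B) (f @^-1` V `+` W V)).
  by apply: meager_bigcup => // V /WP[].
apply/subspace_continuousP => x Nx A /basisB[V [BV Vfx] VA].
have [oW _] := WP V BV.
apply: filterS (_ : within _ (nbhs x) (f @^-1` V)).
  exact: preimage_subset.
have Wx : W V x.
  by apply: contrapT => nW; apply: Nx; exists V => //; left.
apply: (filterS _ (open_nbhs_nbhs (conj oW Wx))) => y Wy Ny.
by apply: contrapT => nVy; apply: Ny; exists V => //; right.
Qed.

(** * Winning strategies *)

Section strategies.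
Local Open Scope ring_scope.
Context {R : realType} {X : topologicalType}.
Context (baireX : forall U : set X, open U -> U !=set0 -> ~ meager U).
Implicit Types (f : X -> R) (G P U V : set X).

Lemma residual_meets G U V : residual_in G U -> V `<=` U ->
  ~ meager V -> G `&` V !=set0.
Proof.
move=> [_ mUG] VU nmV; apply: contrapT => GV0; apply: nmV.
apply: meager_sub mUG => x Vx; split; first exact: VU.
by move=> Gx; apply: GV0; exists x.
Qed.

Lemma GdeltaI G P : Gdelta G -> Gdelta P -> Gdelta (G `&` P).
Proof.
move=> [F oF ->] [H oH ->]; exists (fun n => F n `&` H n).
  by move=> n; exact: openI.
by rewrite bigcapI.
Qed.

(** The open set in which [P] is residual need not lie in [U], but its trace on
[U] serves as [V]: it is non-empty because [P] is, by the Baire category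
theorem. *)
Lemma G_Res_comeager_inside P U : G_Res P -> P `<=` U -> open U ->
  exists V, [/\ open V, V !=set0, V `<=` U & meager (V `\` P)].
Proof.
move=> [_ [V [oV V0 [PV mVP]]]] PU oU; exists (V `&` U); split.
- exact: openI.
- have [|x [Px Vx]] := residual_meets (conj PV mVP) (@subset_refl _ V).
    exact: baireX.
  by exists x; split => //; exact: PU.
- by move=> x [].
- by apply: meager_sub mVP => x [[]].
Qed.

(** Player I plays [U] and then takes points alternately from [f < a] and [f > b].
This is possible because any answer of Player II is residual in a non-empty open
set, which meets [U] in a set where both [f < a] and [f > b] are nonmeager. The
values of [f] along the run diverge, whether or not the points converge. *)
Lemma I_wins_oscillating f a b U : a < b -> open U -> U !=set0 ->
    U `<=` nonmeager_locus [set x | f x < a] ->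
    U `<=` nonmeager_locus [set x | f x > b] ->
  I_has_winning_strategy G_Res f.
Proof.
move=> ab oU [x0 Ux0] Ua Ub.
have ResU : G_Res U.
  split; first exact: open_Gdelta.
  exists U; split => //; first by exists x0.
  by split => //; rewrite setDv; exact: meager0.
pose target n := if odd n then [set x | f x > b] else [set x | f x < a].
(* The number of sets seen so far gives the parity of the turn. *)
pose answer (s : seq (set X)) := xget x0 (last set0 s `&` target (size s)).
have meets Q n : legal_set G_Res U Q -> Q `&` target n !=set0.
  move=> [RQ QU].
  have [V [oV [y Vy] VU mVQ]] := G_Res_comeager_inside RQ QU oU.
  have nmV : ~ meager (target n `&` V).
    have yV : nbhs y V by exact: open_nbhs_nbhs.
    by rewrite /target; case: odd;
      [apply: (Ub y) yV|apply: (Ua y) yV]; exact: VU.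
  apply: contrapT => QT0; apply: nmV; apply: meager_sub mVQ => x [Tx Vx].
  by split => // Qx; apply: QT0; exists x.
exists (U, answer); split => // Q.
have pointP n : legal_set G_Res U (Q n) ->
    (Q n `&` target n.+1) (I_point (U, answer) Q n).
  move=> /(meets _ n.+1)/(xgetPex x0).
  by rewrite /I_point /= /answer size_mkseq mkseqS last_rcons.
split=> [n legQ|legQ [l [_ fl]]].
  by have [] := pointP n (legQ n (leqnn n)).
have leNN N : (N <= N.*2)%N by rewrite -addnn leq_addr.
have fT n := (pointP n (legQ n)).2.
have [lb|bl] := ltP (f l) b.
  have [N _ Nb] := fl _ (lt_nbhsl lb).
  have /= ltb := Nb N.*2 (leNN N).
  have := fT N.*2; rewrite /target /= odd_double /= => /lt_trans/(_ ltb).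
  by rewrite ltxx.
have [N _ Na] := fl _ (lt_nbhsr (lt_le_trans ab bl)).
have /= gta := Na N.*2.+1 (leqW (leNN N)).
have := fT N.*2.+1; rewrite /target /= odd_double /= => /lt_trans/(_ gta).
by rewrite ltxx.
Qed.

(** Let [G] be a residual G-delta set on which [f] is continuous. Player II fixes
at the start a point [p] of [P `&` G] and answers with the trace of [P `&` G] on
smaller and smaller balls around [p], ignoring the points of Player I. These
points then tend to [p] inside a set on which [f] is continuous. *)
Lemma II_wins_continuous (x0 : X) f d N : compatible_metric (d : X -> X -> R) ->
  meager N -> {within ~` N, continuous f} -> II_has_winning_strategy G_Res f.
Proof.
move=> cd /meager_Gdelta[G [GG GN mG]] cf.
have GP0 P : G_Res P -> P `&` G !=set0.
  move=> [_ [U [oU U0 [PU mUP]]]]; apply: contrapT => PG0.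
  apply: (baireX oU U0); apply: meager_sub (meagerU mUP mG) => x Ux.
  have [Gx|] := pselect (G x); last by right.
  by left; split => // Px; apply: PG0; exists x.
pose near0 p n := [set y | d p y < n.+1%:R^-1].
pose focus P := xget x0 (P `&` G).
exists (fun P s => P `&` G `&` near0 (focus P) (size s)); move=> P x RP.
have [Pp Gp] : (P `&` G) (focus P) by apply: xgetPex; exact: GP0.
set p := focus P in Pp Gp *.
have RQ n : G_Res (P `&` G `&` near0 p n).
  have oB : open (near0 p n) by exact: open_metric_ball cd _ _.
  have [GP [U [oU _ [PU mUP]]]] := RP.
  split; first by apply: GdeltaI; [exact: GdeltaI|exact: open_Gdelta].
  exists (U `&` near0 p n); split; first exact: openI.
    exists p; split; first exact: PU.
    by rewrite /near0 /= (cm_refl cd) invr_gt0.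
  split; first by move=> y [[/PU]].
  apply: meager_sub (meagerU mUP mG) => y [[Uy By] nQ].
  have [Gy|] := pselect (G y); last by right.
  by left; split => // Py; exact: nQ.
rewrite /II_set; split=> [n _|xQ].
  by rewrite size_mkseq; split => // y [[]].
have xG n : ~ N (x n) by have [[_ /GN]] := xQ n.
have xp : x @ \oo --> p.
  move=> A /(cm_nbhs cd)[e e0 peA].
  have [//|k] := @ltr_add_invr R 0 e _; rewrite add0r => ke.
  exists k => // n /= kn; apply: peA.
  have [_] := xQ n; rewrite size_mkseq /near0 /= => /lt_trans; apply.
  by apply: le_lt_trans ke; rewrite lef_pV2 ?posrE// ler_nat.
exists p; split => // A fpA.
have /subspace_continuousP/(_ p (GN _ Gp) A fpA) := cf.
by move=> /xp[K _ KA]; exists K => // n Kn; exact: KA Kn (xG n).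
Qed.

End strategies.

Theorem corollary4p5 (R : realType) (X : topologicalType) (f : X -> R)
    (X_nonempty : [set: X] !=set0)
    (X_polish : polish R X)
    (X_no_isolated : isolated [set: X] = set0) :
  determined G_Res f /\
  (baire_measurable f -> II_has_winning_strategy G_Res f) /\
  (~ baire_measurable f -> I_has_winning_strategy G_Res f).
Proof.
have [sepX /completely_metrizable_metric[d [cd complete_d]]] := X_polish.
have scX := separable_second_countable cd sepX.
have baireX := complete_baire cd complete_d.
have II : baire_measurable f -> II_has_winning_strategy G_Res f.
  move=> bf; have [x0 _] := X_nonempty.
  have [V oV|N mN cf] := open_preimages_continuous_off_meager
      (f := f) (realType_second_countable R).
    by apply: bf; exact: open_measurable.
  exact: (II_wins_continuous baireX x0 cd mN cf).
have I : ~ baire_measurable f -> I_has_winning_strategy G_Res f.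
  move=> /(not_baire_measurable_oscillation scX)[a [b [U [ab oU U0 Ua Ub]]]].
  exact: (I_wins_oscillating baireX ab oU U0 Ua Ub).
split; last by [].
by have [/II|/I] := pselect (baire_measurable f); [right|left].
Qed.
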